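(* Let $G$ be a simple connected graph with $n$ vertices and $m$ edges. Then the distance Estrada index $DEE(G)$ and the distance energy $E_{D}(G)$ satisfy $$\frac{1}{2}E_{D}(G)\,(e-1)+n-n_{+}\leq DEE(G)\leq n-1+e^{\frac{E_{D}(G)}{2}},$$ where $n_{+}$ denotes the number of positive $D$-eigenvalues of $G$ (counted with multiplicity). Moreover, equality holds in the left-hand inequality if and only if $G=K_{1}$, and equality holds in the right-hand inequality if and only if $G=K_{1}$, where $K_1$ is the graph with a single vertex.
   Context: Let $G$ be a simple connected graph with vertex set $\{v_1,\dots,v_n\}$. Its distance matrix $D(G)=(d_{ij})$ is the $n\times n$ matrix whose entry $d_{ij}$ is the distance (length of a shortest path) between $v_i$ and $v_j$. The $D$-eigenvalues $\mu_1\ge\mu_2\ge\cdots\ge\mu_n$ of $G$ are the (real) eigenvalues of $D(G)$, counted with multiplicity. The distance Estrada index of $G$ is $DEE(G)=\sum_{i=1}^n e^{\mu_i}$, and the distance energy of $G$ is $E_D(G)=\sum_{i=1}^n|\mu_i|$. Equality of graphs is understood up to isomorphism. *)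

(* Defs.v *)
From HB Require Import structures.
From mathcomp Require Import all_boot all_order all_algebra.
From mathcomp Require Import reals sequences exp.
From mathcomp Require Import polyrcf.

Set Implicit Arguments.
Unset Strict Implicit.
Unset Printing Implicit Defensive.

Import Order.TTheory GRing.Theory Num.Theory.
Local Open Scope ring_scope.

Record sgraph (n : nat) := SGraph {
  adj : rel 'I_n;
  adj_sym : symmetric adj;
  adj_irr : irreflexive adj
}.

Definition edges n (G : sgraph n) : {set {set 'I_n}} :=
  [set [set p.1; p.2] | p : 'I_n * 'I_n & adj G p.1 p.2].

Definition connected_graph n (G : sgraph n) : Prop :=
  forall x y : 'I_n, connect (adj G) x y.

Definition graph_iso n1 n2 (G : sgraph n1) (H : sgraph n2) : Prop :=
  exists2 f : 'I_n1 -> 'I_n2,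
    bijective f & forall x y, adj H (f x) (f y) = adj G x y.

Definition complete_adj n : rel 'I_n := fun x y => x != y.

Lemma complete_adj_sym n : symmetric (@complete_adj n).
Proof. by move=> x y; rewrite /complete_adj eq_sym. Qed.

Lemma complete_adj_irr n : irreflexive (@complete_adj n).
Proof. by move=> x; rewrite /complete_adj eqxx. Qed.

Definition complete_graph n : sgraph n :=
  SGraph (@complete_adj_sym n) (@complete_adj_irr n).

Definition has_path n (G : sgraph n) (x y : 'I_n) (k : nat) : bool :=
  [exists p : k.-tuple 'I_n,
     [&& path (adj G) x p, last x p == y & uniq (x :: p)]].

(* Vertices along a path are distinct, so its length is at most n - 1 and the
   search over k < n is exhaustive. When x and y are not connected, the value
   is n, which plays no role for connected graphs. *)
Definition gdist n (G : sgraph n) (x y : 'I_n) : nat :=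
  find (has_path G x y) (iota 0 n).

Definition distance_matrix (R : realType) n (G : sgraph n) : 'M[R]_n :=
  \matrix_(i, j) (gdist G i j)%:R.

(* rootsR lists the distinct real roots in increasing order; each one is
   repeated according to its algebraic multiplicity, and the result is in
   nonincreasing order. A real symmetric matrix has only real eigenvalues, so
   for such a matrix no eigenvalue is left out. *)
Definition real_spectrum (R : realType) n (A : 'M[R]_n) : seq R :=
  flatten [seq nseq (mup x (char_poly A)) x | x <- rev (rootsR (char_poly A))].

Definition D_eigenvalues (R : realType) n (G : sgraph n) : seq R :=
  real_spectrum (distance_matrix R G).

Definition DEE (R : realType) n (G : sgraph n) : R :=
  \sum_(mu <- D_eigenvalues R G) expR mu.

Definition distance_energy (R : realType) n (G : sgraph n) : R :=
  \sum_(mu <- D_eigenvalues R G) `|mu|.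

Definition n_pos (R : realType) n (G : sgraph n) : nat :=
  count (fun mu : R => 0 < mu) (D_eigenvalues R G).

(* Main.v *)
Require Import Defs.
From HB Require Import structures.
From mathcomp Require Import all_boot all_order all_algebra.
From mathcomp Require Import reals sequences exp.
From mathcomp Require Import sesquilinear spectral polyrcf complex ring lra.

Set Implicit Arguments.
Unset Strict Implicit.
Unset Printing Implicit Defensive.

Import Order.TTheory GRing.Theory Num.Theory.
Local Open Scope ring_scope.

(** The distance matrix D is real symmetric, so it is unitarily diagonalizable
    with real eigenvalues: its characteristic polynomial splits over the reals
    and the listed D-eigenvalues are n numbers ([D_eigenvalues_spec]). They sum
    to the trace of D, which is zero, and they vanish simultaneously only if
    D = 0, that is, only if n <= 1, because distinct vertices are at nonzero
    distance.

    Everything else concerns finite families of reals x with sum zero. For such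
    a family, the sum of the positive members is half of the sum of the |x|.

    Lower bound: expR x is at least expR 1 * x (tangent at 1) for positive x,
    and at least 1 + x (tangent at 0) for the other x; summing gives
    [zero_sum_expR_lower]. In the case of equality no x is negative, since the
    tangent inequality at 0 is strict away from 0.

    Upper bound: expR x is at most expR (max x 0), and expR - 1 is superadditive
    on nonnegative reals; this gives [zero_sum_expR_upper]. In the case of
    equality x = max x 0 for all x, so again no x is negative.

    Nonnegative reals with sum zero are all zero, so in both cases of equality
    all D-eigenvalues vanish and G is a single vertex. Conversely, the only
    D-eigenvalue of a single vertex is 0, and both equalities are immediate. *)

(** * Spectrum of a real symmetric matrix *)

Lemma char_poly_conj (F : fieldType) n (P B : 'M[F]_n) :
  P \in unitmx -> char_poly (invmx P *m B *m P) = char_poly B.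
Proof.
move=> Pu; rewrite /char_poly /char_poly_mx.
set Pp := map_mx polyC P; set Vp := map_mx polyC (invmx P).
have VP : Vp *m Pp = 1%:M by rewrite -map_mxM mulVmx // map_mx1.
have -> : 'X%:M - map_mx polyC (invmx P *m B *m P) =
    Vp *m ('X%:M - map_mx polyC B) *m Pp.
  by rewrite !map_mxM mulmxBr mulmxBl mul_mx_scalar -scalemxAl VP scalemx1.
by rewrite !det_mulmx mulrAC -det_mulmx VP det1 mul1r.
Qed.

(** Spectral theorem over a real closed field, obtained from the
    diagonalization of hermitian matrices over its complex extension. The last
    clause says that a symmetric matrix with zero spectrum is zero. *)
Lemma symmetric_spectral (R : rcfType) n (A : 'M[R]_n) : A^T = A ->
  exists s : seq R,
    [/\ size s = n, char_poly A = \prod_(x <- s) ('X - x%:P)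
      & {in s, forall x, x = 0} -> A = 0].
Proof.
move=> symA; pose f : {rmorphism R -> R[i]} := real_complex R.
pose B := map_mx f A.
have realB : B \is a realmx.
  by apply/mxOverP => i j; rewrite mxE complex_real.
have hermB : B \is hermsymmx.
  apply: realsym_hermsym => //; apply/is_hermitianmxP.
  by rewrite expr0 scale1r map_mx_id // map_trmx symA.
have realD := hermitian_spectral_diag_real hermB.
have /orthomx_spectralP := hermitian_normalmx hermB.
have Pu := spectral_unit B.
set P := spectralmx B in Pu *; set d := spectral_diag B in realD * => eqB.
pose r i := complex.Re (d 0 i).
have rE i : f (r i) = d 0 i.
  by apply: RRe_real; move/mxOverP: realD; apply.
exists [seq r i | i : 'I_n]; split.
- by rewrite size_map size_enum_ord.
- apply: (map_poly_inj f); rewrite map_char_poly -/B eqB char_poly_conj //.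
  rewrite big_map map_prod_XsubC char_poly_trig ?diag_mx_is_trig // big_enum.
  by apply: eq_bigr => i _; rewrite mxE eqxx mulr1n rE.
- move=> r0; apply: (map_mx_inj (f := f)); rewrite map_mx0 -/B eqB.
  suff -> : d = 0 by rewrite linear0 mulmx0 mul0mx.
  by apply/rowP => i; rewrite mxE -rE (r0 (r i)) ?rmorph0 // map_f // mem_enum.
Qed.

Lemma sum_roots_trace (F : comNzRingType) n (A : 'M[F]_n) (s : seq F) :
  size s = n -> char_poly A = \prod_(x <- s) ('X - x%:P) ->
  \sum_(x <- s) x = \tr A.
Proof.
case: n A => [|n] A size_s eqA.
  by rewrite (size0nil size_s) big_nil /mxtrace big_ord0.
by apply: oppr_inj; rewrite -char_poly_trace // eqA -coefPn_prod_XsubC size_s.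
Qed.

(** When the characteristic polynomial splits, [real_spectrum] misses no
    eigenvalue and counts each with the right multiplicity. *)
Lemma perm_real_spectrum (R : realType) n (A : 'M[R]_n) (s : seq R) :
  char_poly A = \prod_(x <- s) ('X - x%:P) -> perm_eq (real_spectrum A) s.
Proof.
move=> eqA; rewrite /real_spectrum eqA.
under eq_map => x do rewrite mu_prod_XsubC.
apply: perm_trans (perm_count_undup s).
apply/perm_flatten/perm_map/uniq_perm.
- by rewrite rev_uniq uniq_roots.
- exact: undup_uniq.
have p0 : \prod_(x <- s) ('X - x%:P) != 0 :> {poly R}.
  by rewrite monic_neq0 // monic_prod_XsubC.
move=> x; rewrite mem_rev mem_undup -(root_prod_XsubC s).
by move: (roots_on_rootsR p0 x); rewrite itv_boundlr /= => <-.
Qed.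

(** * Exponential sums over real families of sum zero *)

Section ZeroSum.

Variables (R : realType) (s : seq R).
Hypothesis sum0 : \sum_(x <- s) x = 0.

Lemma zero_sum_ge0_eq0 : {in s, forall x, 0 <= x} -> {in s, forall x, x = 0}.
Proof.
move=> s_ge0.
have : \sum_(x <- s) `|x| == 0.
  by rewrite -[X in _ == X]sum0; apply/eqP/eq_big_seq => x /s_ge0/ger0_norm.
rewrite psumr_eq0 => [/allP s0 x xs|//].
by apply/eqP; rewrite -normr_eq0; exact: (s0 x xs).
Qed.

Lemma expR_ge_tangent1 (x : R) : expR 1 * x <= expR x.
Proof.
have -> : expR x = expR 1 * expR (x - 1) by rewrite -expRD addrC subrK.
by rewrite ler_pM2l ?expR_gt0 //; have := expR_ge1Dx (x - 1); lra.
Qed.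

(** The difference between expR x and the tangent line used at x: the tangent
    at 1 when x > 0, and the tangent at 0 otherwise ([lower_gap_pos] and
    [lower_gap_npos]). The term linear in x balances the two cases and
    disappears in sums over a family of sum zero. *)
Definition lower_gap (x : R) : R :=
  expR x - (2^-1 * `|x| * (expR 1 - 1) + 1 - (0 < x)%R%:R
            + (expR 1 + 1) / 2 * x).

Lemma lower_gap_pos x : 0 < x -> lower_gap x = expR x - expR 1 * x.
Proof. by move=> x0; rewrite /lower_gap x0 gtr0_norm //= mulr1n; field. Qed.

Lemma lower_gap_npos x : x <= 0 -> lower_gap x = expR x - (1 + x).
Proof.
by move=> x0; rewrite /lower_gap ltNge x0 /= mulr0n ler0_norm //; field.
Qed.

Lemma lower_gap_ge0 x : 0 <= lower_gap x.
Proof.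
have [x0|x0] := ltP 0 x.
  by rewrite lower_gap_pos // subr_ge0 expR_ge_tangent1.
by rewrite lower_gap_npos // subr_ge0 expR_ge1Dx.
Qed.

Lemma lower_gap_eq0_ge0 x : lower_gap x = 0 -> 0 <= x.
Proof.
have [/ltW //|x0] := ltP 0 x.
rewrite lower_gap_npos // => /eqP; rewrite subr_eq0.
by have [->|/expR_gt1Dx /gt_eqF ->] := eqVneq x 0.
Qed.

Lemma sum_lower_gap :
  \sum_(x <- s) lower_gap x =
  \sum_(x <- s) expR x -
  (2^-1 * (\sum_(x <- s) `|x|) * (expR 1 - 1) + (size s)%:R
   - (count (fun x => 0 < x) s)%:R).
Proof.
rewrite /lower_gap sumrB big_split /= sumrB big_split /=.
rewrite -mulr_suml -!mulr_sumr sum0 mulr0 addr0.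
have -> : \sum_(x <- s) 1 = (size s)%:R :> R by rewrite -sum1_size natr_sum.
by rewrite -natr_sum -sumn_count; congr (_ - (_ - _%:R)); rewrite sumnE big_map.
Qed.

Lemma zero_sum_expR_lower :
  2^-1 * (\sum_(x <- s) `|x|) * (expR 1 - 1) + (size s)%:R
    - (count (fun x => 0 < x) s)%:R
  <= \sum_(x <- s) expR x.
Proof.
by rewrite -subr_ge0 -sum_lower_gap sumr_ge0 // => x _; exact: lower_gap_ge0.
Qed.

Lemma zero_sum_expR_lower_eq :
  2^-1 * (\sum_(x <- s) `|x|) * (expR 1 - 1) + (size s)%:R
    - (count (fun x => 0 < x) s)%:R
  = \sum_(x <- s) expR x -> {in s, forall x, x = 0}.
Proof.
move=> /esym/eqP; rewrite -subr_eq0 -sum_lower_gap psumr_eq0; last first.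
  by move=> x _; exact: lower_gap_ge0.
move=> /allP gap0; apply: zero_sum_ge0_eq0 => x xs.
by apply/lower_gap_eq0_ge0/eqP; exact: (gap0 x xs).
Qed.

(** Superadditivity of expR - 1 on nonnegative reals, since
    (expR x - 1) * (expR y - 1) >= 0. *)
Lemma sum_expR_superadd (t : seq R) : {in t, forall x, 0 <= x} ->
  \sum_(x <- t) (expR x - 1) <= expR (\sum_(x <- t) x) - 1.
Proof.
elim: t => [|x t IHt] t_ge0; first by rewrite !big_nil expR0 subrr.
have x_ge0 : 0 <= x by rewrite t_ge0 ?mem_head.
have {}t_ge0 : {in t, forall y, 0 <= y}.
  by move=> y yt; rewrite t_ge0 // inE yt orbT.
rewrite !big_cons expRD.
apply: (le_trans (lerD (lexx _) (IHt t_ge0))).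
have : 0 <= (expR x - 1) * (expR (\sum_(y <- t) y) - 1).
  by rewrite mulr_ge0 // subr_ge0 -expR0 ler_expR // big_seq sumr_ge0.
by lra.
Qed.

Lemma sum_max0 : \sum_(x <- s) Num.max x 0 = (\sum_(x <- s) `|x|) / 2.
Proof.
have maxE (x : R) : Num.max x 0 = (`|x| + x) / 2.
  by case: ltrgt0P => x0; lra.
by under eq_bigr do rewrite maxE; rewrite -mulr_suml big_split /= sum0 addr0.
Qed.

Lemma expR_le_max0 (x : R) : expR x <= expR (Num.max x 0).
Proof. by rewrite ler_expR le_max lexx. Qed.

Lemma sum_expR_max0 :
  \sum_(x <- s) expR (Num.max x 0) <=
  (size s)%:R - 1 + expR ((\sum_(x <- s) `|x|) / 2).
Proof.
have : {in map (Num.max^~ 0) s, forall x, 0 <= x}.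
  by move=> _ /mapP[x _ ->]; rewrite le_max lexx orbT.
move=> /sum_expR_superadd; rewrite !big_map sum_max0 sumrB.
have -> : \sum_(x <- s) 1 = (size s)%:R :> R by rewrite -sum1_size natr_sum.
by lra.
Qed.

Lemma zero_sum_expR_upper :
  \sum_(x <- s) expR x <= (size s)%:R - 1 + expR ((\sum_(x <- s) `|x|) / 2).
Proof.
by apply: le_trans sum_expR_max0; apply: ler_sum => x _; exact: expR_le_max0.
Qed.

Lemma zero_sum_expR_upper_eq :
  \sum_(x <- s) expR x = (size s)%:R - 1 + expR ((\sum_(x <- s) `|x|) / 2) ->
  {in s, forall x, x = 0}.
Proof.
move=> eq_sum; have := sum_expR_max0; rewrite -eq_sum -subr_le0 -sumrB => le0.
have : \sum_(x <- s) (expR (Num.max x 0) - expR x) == 0.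
  by rewrite eq_le le0 sumr_ge0 // => x _; rewrite subr_ge0 expR_le_max0.
rewrite psumr_eq0 => [|x _]; last by rewrite subr_ge0 expR_le_max0.
move=> /allP gap0; apply: zero_sum_ge0_eq0 => x xs.
move: (gap0 x xs); rewrite /= subr_eq0 => /eqP/expR_inj <-.
by rewrite le_max lexx orbT.
Qed.

End ZeroSum.

(** * Distance matrix of a graph *)

Lemma has_path_sym n (G : sgraph n) x y : has_path G x y =1 has_path G y x.
Proof.
suff sub u v k : has_path G u v k -> has_path G v u k.
  by move=> k; apply/idP/idP; exact: sub.
case/existsP => p /and3P[Gp /eqP lastp Up].
have size_rp : size (rev (belast u p)) == k.
  by rewrite size_rev size_belast size_tuple.
have revE : rev (u :: p) = v :: rev (belast u p).
  by rewrite lastI lastp rev_rcons.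
apply/existsP; exists (Tuple size_rp) => /=; apply/and3P; split.
- rewrite -lastp rev_path (eq_path (e' := adj G)) // => a b.
  by rewrite adj_sym.
- by rewrite -[last _ _]/(last v (v :: _)) -revE rev_cons last_rcons.
- by rewrite -[_ && _]/(uniq (v :: rev (belast u p))) -revE rev_uniq.
Qed.

Lemma gdist_sym n (G : sgraph n) x y : gdist G x y = gdist G y x.
Proof. exact/eq_find/has_path_sym. Qed.

Lemma has_path0 n (G : sgraph n) x y : has_path G x y 0 = (x == y).
Proof.
apply/existsP/eqP => [[p]|<-]; first by rewrite tuple0 => /and3P[_ /eqP].
by exists [tuple] => /=; rewrite eqxx.
Qed.

Lemma gdist_eq0 n (G : sgraph n) x y : (gdist G x y == 0)%N = (x == y).
Proof.
rewrite -(has_path0 G) /gdist; case: n G x y => [? []//|n] G x y /=.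
by case: ifP.
Qed.

Lemma distance_matrix_sym (R : realType) n (G : sgraph n) :
  (distance_matrix R G)^T = distance_matrix R G.
Proof. by apply/matrixP => i j; rewrite !mxE gdist_sym. Qed.

Lemma distance_matrix_trace (R : realType) n (G : sgraph n) :
  \tr (distance_matrix R G) = 0.
Proof.
by apply: big1 => i _; rewrite mxE; apply/eqP; rewrite pnatr_eq0 gdist_eq0.
Qed.

(** Distinct vertices have a nonzero entry, even if they are not connected. *)
Lemma distance_matrix0 (R : realType) n (G : sgraph n) :
  distance_matrix R G = 0 -> (n <= 1)%N.
Proof.
case: n G => [|[|n]] G // /matrixP/(_ ord0 ord_max)/eqP.
by rewrite !mxE pnatr_eq0 gdist_eq0.
Qed.

(** All that the bounds and their equality cases use about the graph: n
    eigenvalues, sum zero, and a zero spectrum only when n <= 1. *)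
Lemma D_eigenvalues_spec (R : realType) n (G : sgraph n) :
  [/\ size (D_eigenvalues R G) = n, \sum_(x <- D_eigenvalues R G) x = 0
    & {in D_eigenvalues R G, forall x, x = 0} -> (n <= 1)%N].
Proof.
have [s [size_s eqs s0]] := symmetric_spectral (distance_matrix_sym R G).
have perm_s := perm_real_spectrum eqs.
rewrite (perm_size perm_s) (perm_big _ perm_s) /=; split=> // [|D0].
  by rewrite (sum_roots_trace size_s eqs) distance_matrix_trace.
apply: (@distance_matrix0 R _ G); apply: s0 => x.
by rewrite -(perm_mem perm_s); exact: D0.
Qed.

Lemma graph_iso_K1 n (G : sgraph n) :
  graph_iso G (complete_graph 1) <-> n = 1%N.
Proof.
split=> [[f /bij_eq_card]|n1]; first by rewrite !card_ord.
case: _ / (esym n1) G => G; exists id; first by exists id.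
by move=> x y; rewrite !ord1 !adj_irr.
Qed.

Theorem theorem3p1 (R : realType) (n m : nat) (G : sgraph n)
    (n_gt0 : (0 < n)%N) (G_conn : connected_graph G) (G_size : #|edges G| = m) :
  [/\ 2^-1 * distance_energy R G * (expR 1 - 1) + n%:R - (n_pos R G)%:R
        <= DEE R G,
      DEE R G <= n%:R - 1 + expR (distance_energy R G / 2),
      2^-1 * distance_energy R G * (expR 1 - 1) + n%:R - (n_pos R G)%:R
        = DEE R G <-> graph_iso G (complete_graph 1)
    & DEE R G = n%:R - 1 + expR (distance_energy R G / 2)
        <-> graph_iso G (complete_graph 1)].
Proof.
have [size_D sum_D D0] := D_eigenvalues_spec R G.
have n1 : {in D_eigenvalues R G, forall x, x = 0} ->
    graph_iso G (complete_graph 1).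
  by move=> /D0 n_le1; apply/graph_iso_K1/eqP; rewrite eqn_leq n_le1.
have D1 : graph_iso G (complete_graph 1) -> D_eigenvalues R G = [:: 0].
  move=> /graph_iso_K1 n_eq1.
  case: (D_eigenvalues R G) (etrans size_D n_eq1) sum_D => [|x []] //= _.
  by rewrite big_seq1 => ->.
have lowerP := zero_sum_expR_lower sum_D.
have lower_eqP := zero_sum_expR_lower_eq sum_D.
have upperP := zero_sum_expR_upper sum_D.
have upper_eqP := zero_sum_expR_upper_eq sum_D.
rewrite size_D in lowerP lower_eqP upperP upper_eqP.
split=> //.
- split=> [/lower_eqP/n1 //|isoG]; have := size_D.
  rewrite /distance_energy /n_pos /DEE D1 //= => <-.
  by rewrite !big_seq1 normr0 expR0 ltxx /= mulr0n; ring.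
- split=> [/upper_eqP/n1 //|isoG]; have := size_D.
  rewrite /distance_energy /DEE D1 //= => <-.
  by rewrite !big_seq1 normr0 mul0r expR0; ring.
Qed.
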